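(* Let $\mu$ be a Borel probability measure on $[0,1]^2$ (with points written $(x,t)$) whose marginal with respect to the variable $t$ is the Lebesgue measure $dt$ on $[0,1]$, and let $$\gamma_i(j)=\int_{[0,1]^2} t^j x^i\,d\mu(x,t),\qquad i,j=0,1,\ldots,$$ with $\boldsymbol{\gamma}_i=(\gamma_i(j))_{j\ge 0}$. (a) If $\mu$ is supported on a trajectory $\{(t,x(t)) : t\in[0,1]\}$ for some nonnegative measurable function $t\mapsto x(t)$ on $[0,1]$, with values in $[0,1]$, and if $$\sup_n\Big\Vert \sum_{j=0}^n \hat{\boldsymbol{x}}(j)\,\mathscr{L}_j\Big\Vert_\infty<\infty ,$$ then $$\hat{\boldsymbol{x}}_i=\hat{\boldsymbol{x}}^{(i)}=\underbrace{\hat{\boldsymbol{x}}\star\cdots\star\hat{\boldsymbol{x}}}_{i\text{ times}}=\hat{\boldsymbol{x}}_{i-1}\star\hat{\boldsymbol{x}},\qquad \forall\, i=2,3,\ldots \qquad (\mathrm{I})$$ Equivalently, $$\boldsymbol{\Delta}\boldsymbol{\gamma}_i=(\boldsymbol{\Delta}\boldsymbol{\gamma}_1)^{(i)}=\boldsymbol{\Delta}\boldsymbol{\gamma}_{i-1}\star\boldsymbol{\Delta}\boldsymbol{\gamma}_1,\qquad \forall\, i=2,3,\ldots \qquad (\mathrm{II})$$ (Each equality includes the assertion that the limit in $\ell^2$ defining its right-hand side exists.) (b) Conversely, if (II) holds, then $\mu$ is supported on a trajectory $\{(t,x(t)) : t\in[0,1]\}$ for some measurable function $t\mapsto x(t)$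 from $[0,1]$ to $[0,1]$, and (I) also holds for this function.
   Context: $\Vert\cdot\Vert_\infty$ is the (essential) sup norm on $[0,1]$. $(\mathscr{L}_j)_{j\ge0}$ denotes the shifted Legendre polynomials: the polynomials orthonormal with respect to Lebesgue measure on $[0,1]$, with $\deg\mathscr{L}_j=j$ and positive leading coefficient; they form an orthonormal basis of $L_2([0,1])$. Write $\mathscr{L}_j(t)=\sum_{k=0}^j\Delta_{jk}t^k$ (so $\Delta_{jj}>0$), and let $\boldsymbol{\Delta}=(\Delta_{jk})$ be the resulting infinite lower triangular matrix; for a sequence $\boldsymbol{\gamma}=(\gamma(j))_{j\ge0}$, $\boldsymbol{\Delta}\boldsymbol{\gamma}$ is the sequence $(\boldsymbol{\Delta}\boldsymbol{\gamma})(j)=\sum_{k=0}^j\Delta_{jk}\gamma(k)$. ''$\mu$ is supported on a trajectory $\{(t,x(t)):t\in[0,1]\}$'' means that $d\mu(x,t)=\delta_{x(t)}(dx)\,dt$, i.e. $\mu$ is concentrated on the set of points whose $x$-coordinate equals $x(t)$. For $f\in L_2([0,1])$ its (shifted) Legendre--Fourier coefficients are $\hat{\boldsymbol{f}}(j)=\int_0^1\mathscr{L}_j(t)f(t)\,dt$, $j=0,1,\ldots$. For a measurable function $x:[0,1]\to[0,1]$, $\hat{\boldsymbol{x}}=(\hat{\boldsymbol{x}}(j))$ denotes the Legendre--Fourier coefficients of $t\mapsto x(t)$, and $\hat{\boldsymbol{x}}_i$ those of $t\mapsto x(t)^i$ (so $\hat{\boldsymbol{x}}_1=\hat{\boldsymbol{x}}$).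 For a sequence $a=(a(j))_{j\ge0}$ and $k,n\in\mathbb{N}$, let $a_n^{(k)}\in\mathbb{R}^{kn+1}$ be the vector of coefficients defined by $\big(\sum_{j=0}^n a(j)\mathscr{L}_j(t)\big)^k=\sum_{j=0}^{kn}a_n^{(k)}(j)\mathscr{L}_j(t)$, regarded as an element of $\ell^2$ by completing with zeros. If $a_n^{(k)}$ converges in $\ell^2$ as $n\to\infty$, its limit is denoted $a^{(k)}$. This limit is also denoted $a\star\cdots\star a$ ($k$ times), and one also writes $a^{(k)}=a^{(k-1)}\star a$: thus, for a sequence $b=a^{(k-1)}$, $b\star a$ denotes $a^{(k)}$, i.e. the $\ell^2$-limit as $n\to\infty$ of the coefficient vectors in the basis $(\mathscr{L}_j)$ of the products $\big(\sum_{j=0}^{(k-1)n} a_n^{(k-1)}(j)\mathscr{L}_j\big)\big(\sum_{j=0}^n a(j)\mathscr{L}_j\big)$. *)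

(* Defs.v *)
From HB Require Import structures.
From mathcomp Require Import all_boot all_order all_algebra.
From mathcomp Require Import all_classical all_reals all_analysis.

Set Implicit Arguments.
Unset Strict Implicit.
Unset Printing Implicit Defensive.

Import Order.TTheory GRing.Theory Num.Theory.
Import numFieldNormedType.Exports.

Local Open Scope classical_set_scope.
Local Open Scope ring_scope.

Definition I01 (R : realType) : set R := `[0, 1].
Arguments I01 {R}.

Lemma measurable_I01 (R : realType) : measurable (@I01 R : set (measurableTypeR R)).
Proof. exact: measurable_itv. Qed.

Definition lebesgue01 (R : realType) :
    {measure set (measurableTypeR R) -> \bar R} :=
  mrestr (@lebesgue_measure R) (@measurable_I01 R).

Definition sup_norm01 (R : realType) (f : R -> R) : \bar R :=
  'N[lebesgue01 R]_(+oo)[EFin \o f]%E.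

(* These three conditions determine the family [L] uniquely. *)
Definition shifted_legendre (R : realType) (L : nat -> {poly R}) : Prop :=
  [/\ forall j, size (L j) = j.+1,
      forall j, 0 < lead_coef (L j) &
      forall j k,
        \int[lebesgue_measure]_(t in I01) ((L j).[t] * (L k).[t]) = (j == k)%:R].

Definition legendre_sum (R : realType) (L : nat -> {poly R}) (n : nat)
    (a : nat -> R) : {poly R} :=
  \sum_(j < n.+1) a j *: L j.

Definition legendre_expansion (R : realType) (L : nat -> {poly R}) (n : nat)
    (p : {poly R}) (c : nat -> R) : Prop :=
  p = legendre_sum L n c /\ forall j, (n < j)%N -> c j = 0.

(* The coordinates of [p] in the basis [L 0, ..., L n], padded with zeros; the
   default value of [xget] is never reached in degree at most [n], see
   [legendre_coordP]. *)
Definition legendre_coord (R : realType) (L : nat -> {poly R}) (n : nat)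
    (p : {poly R}) : nat -> R :=
  xget (fun=> 0) [set c | legendre_expansion L n p c].

Lemma legendre_coordP (R : realType) (L : nat -> {poly R}) (n : nat)
    (p : {poly R}) :
  (forall j, size (L j) = j.+1) -> (size p <= n.+1)%N ->
  legendre_expansion L n p (legendre_coord L n p).
Proof.
move=> sL sp; suff [c Hc] : exists c, legendre_expansion L n p c.
  exact: (@xgetPex _ (fun=> 0) [set c | legendre_expansion L n p c]) (ex_intro _ c Hc).
elim: n p sp => [|n IHn] p sp.
  exists (fun j => if j == 0%N then p`_0 / (L 0%N)`_0 else 0); split; last by case.
  have L0 : (L 0%N)`_0 != 0.
    have := lead_coef_eq0 (L 0%N); rewrite lead_coefE sL /= => ->.
    by rewrite -size_poly_eq0 sL.
  rewrite /legendre_sum big_ord_recl big_ord0 addr0 /=.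
  rewrite (size1_polyC sp) [L 0%N]size1_polyC ?sL// !coefC /=.
  by rewrite -mul_polyC -polyCM divfK.
have Ln : (L n.+1)`_n.+1 != 0.
  have := lead_coef_eq0 (L n.+1); rewrite lead_coefE sL /= => ->.
  by rewrite -size_poly_eq0 sL.
pose a := p`_n.+1 / (L n.+1)`_n.+1.
have [|c [pE c0]] := IHn (p - a *: L n.+1).
  apply/leq_sizeP => j; rewrite leq_eqVlt => /predU1P[<-|nj].
    by rewrite coefB coefZ divfK ?subrr.
  rewrite coefB coefZ (leq_sizeP _ _ sp)// [(L n.+1)`_j]nth_default ?sL//.
  by rewrite mulr0 subr0.
exists (fun j => if j == n.+1 then a else c j); split; last first.
  by move=> j nj; rewrite gtn_eqF// c0// ltnW.
rewrite /legendre_sum big_ord_recr /= eqxx -[LHS](subrK (a *: L n.+1)) pE.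
congr (_ + _); apply: eq_bigr => i _.
by rewrite ltn_eqF ?ltn_ord.
Qed.

Definition fourier_legendre (R : realType) (L : nat -> {poly R})
    (f : R -> R) (j : nat) : R :=
  \int[lebesgue_measure]_(t in I01) ((L j).[t] * f t).

Definition Delta_mul (R : realType) (L : nat -> {poly R}) (g : nat -> R)
    (j : nat) : R :=
  \sum_(k < j.+1) (L j)`_k * g k.

Definition l2norm (R : realType) (a : nat -> R) : \bar R :=
  'N[counting]_(2%:E)[EFin \o a]%E.

Definition cvg_l2 (R : realType) (u : nat -> nat -> R) (b : nat -> R) : Prop :=
  (l2norm b < +oo)%E /\
  l2norm (fun j => u n j - b j) @[n --> \oo] --> 0%E.

(* $a_n^{(k)}$ *)
Definition trunc_pow (R : realType) (L : nat -> {poly R}) (k : nat)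
    (a : nat -> R) (n : nat) : nat -> R :=
  legendre_coord L (k * n) (legendre_sum L n a ^+ k).

(* "$a^{(k)}$ exists and equals [c]" *)
Definition is_conv_pow (R : realType) (L : nat -> {poly R}) (k : nat)
    (a c : nat -> R) : Prop :=
  cvg_l2 (trunc_pow L k a) c.

(* "[b] is $a^{(k-1)}$, and $b \star a$ exists and equals [c]"; the truncations
   of [b] used in the product are the $a_n^{(k-1)}$, hence the dependence on
   [k]. *)
Definition is_star (R : realType) (L : nat -> {poly R}) (k : nat)
    (b a c : nat -> R) : Prop :=
  is_conv_pow L k.-1 a b /\
  cvg_l2 (fun n => legendre_coord L (k * n)
            (legendre_sum L (k.-1 * n) (trunc_pow L k.-1 a n) *
             legendre_sum L n a)) c.

(* $b_i = b_1^{(i)} = b_{i-1} \star b_1$ for all $i \ge 2$ *)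
Definition power_identities (R : realType) (L : nat -> {poly R})
    (b : nat -> nat -> R) : Prop :=
  forall i, (2 <= i)%N ->
    is_conv_pow L i (b 1%N) (b i) /\ is_star L i (b i.-1) (b 1%N) (b i).

(* Points of the square are written $(x, t)$: [t] is the second coordinate. *)
Definition moment (R : realType)
    (mu : probability (measurableTypeR R * measurableTypeR R)%type R)
    (i j : nat) : R :=
  \int[mu]_(p in I01 `*` I01) (p.2 ^+ j * p.1 ^+ i).

(* $d\mu(x,t) = \delta_{x(t)}(dx)\,dt$ *)
Definition supported_on_trajectory (R : realType)
    (mu : probability (measurableTypeR R * measurableTypeR R)%type R)
    (x : R -> R) : Prop :=
  forall A : set (measurableTypeR R * measurableTypeR R), measurable A ->
    mu A = (\int[lebesgue_measure]_(t in I01) \d_(x t) (ysection A t))%E.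

Definition trajectory (R : realType) (x : R -> R) : Prop :=
  measurable_fun I01 (x : measurableTypeR R -> measurableTypeR R) /\
  forall t, I01 t -> I01 (x t).

Definition fourier_pow (R : realType) (L : nat -> {poly R}) (x : R -> R)
    (i : nat) : nat -> R :=
  fourier_legendre L (fun t => x t ^+ i).

Definition identity_I (R : realType) (L : nat -> {poly R}) (x : R -> R) : Prop :=
  power_identities L (fourier_pow L x).

Definition identity_II (R : realType) (L : nat -> {poly R})
    (mu : probability (measurableTypeR R * measurableTypeR R)%type R) : Prop :=
  power_identities L (fun i => Delta_mul L (moment mu i)).

(* Main.v *)
Require Import Defs.
From HB Require Import structures.
From mathcomp Require Import all_boot all_order all_algebra.
From mathcomp Require Import all_classical all_reals all_analysis.
From mathcomp Require Import measurable_realfun ess_sup_inf.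
From mathcomp Require Import ring lra.

Set Implicit Arguments.
Unset Strict Implicit.
Unset Printing Implicit Defensive.

Import Order.TTheory GRing.Theory Num.Theory.
Import numFieldNormedType.Exports.

Local Open Scope classical_set_scope.
Local Open Scope ring_scope.

(** Write $s_n$ for the partial sums of the Legendre series.

    The coefficients $\Delta\gamma_i$ are the integrals of $\mathscr{L}_j(t)x^i$ with
    respect to $\mu$. When $\mu$ sits on the trajectory of [x] they are the
    coefficients of $x^i$ ([Delta_mul_moment_trajectory]), so (I) and (II) are the
    same statement. Moreover $s_n^{i-1}s_n=s_n^i$, so the two equalities for a given
    $i$ concern one and the same sequence ([is_star_conv_pow]).

    Direct part. The polynomials are dense in $L_2([0,1])$ ([polynomial_dense]), so
    $s_n\to x$ in $L_2$ ([legendre_series_cvg]). As the $s_n$ are uniformly bounded,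
    $|s_n^i-x^i|\le C|s_n-x|$ almost everywhere, hence $s_n^i\to x^i$ in $L_2$, and
    Bessel's inequality carries this to the coefficients ([is_conv_pow_bounded]).

    Converse. The functions $\mathscr{L}_j(t)$ are orthonormal in $L_2(\mu)$ because
    of the marginal, and $a=\Delta\gamma_1$ lists the coefficients of the function
    $(x,t)\mapsto x$. By Pythagoras the square of its distance to $s_n(t)$ is
    $\int x^2\,d\mu-\sum_{j\le n}a(j)^2$, and the identity (II) for $i=2$, read at
    the coordinate of index $0$, says precisely that this tends to $0$
    ([legendre_sum_cvg_square]). A subsequence of $s_n(t)$ then tends to $x$ almost
    everywhere for $\mu$, so $x$ is a function of $t$
    ([trajectory_of_identity_II]). *)

(** * Bounded measurable functions and orthonormal families *)

Section BoundedMeasurable.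
Context d (T : measurableType d) (R : realType).
Implicit Types (D : set T) (f g : T -> R).

(** Polynomials and trajectories are bounded on the sets of integration. This class
    is closed under sums, products and polynomials and consists of integrable
    functions when the measure of [D] is finite, so it takes care of nearly all
    integrability conditions. *)
Definition bounded_measurable D f :=
  measurable_fun D f /\ exists M, forall t, D t -> `|f t| <= M.

Lemma bounded_measurable_cst D r : bounded_measurable D (fun=> r).
Proof. by split; [exact: measurable_cst|exists `|r|]. Qed.

Lemma bounded_measurableD D f g : bounded_measurable D f ->
  bounded_measurable D g -> bounded_measurable D (fun t => f t + g t).
Proof.
move=> [mf [M fM]] [mg [N gN]]; split; first exact: measurable_funD.
exists (M + N) => t Dt; apply: le_trans (ler_normD _ _) _.
by rewrite lerD ?fM ?gN.
Qed.

Lemma bounded_measurableM D f g : bounded_measurable D f ->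
  bounded_measurable D g -> bounded_measurable D (fun t => f t * g t).
Proof.
move=> [mf [M fM]] [mg [N gN]]; split; first exact: measurable_funM.
by exists (M * N) => t Dt; rewrite normrM ler_pM ?fM ?gN.
Qed.

Lemma bounded_measurableB D f g : bounded_measurable D f ->
  bounded_measurable D g -> bounded_measurable D (fun t => f t - g t).
Proof.
move=> bf bg; have := bounded_measurableD bf
  (bounded_measurableM (bounded_measurable_cst D (-1)) bg).
by congr bounded_measurable; apply/funext => t; rewrite mulN1r.
Qed.

Lemma bounded_measurableX D f n : bounded_measurable D f ->
  bounded_measurable D (fun t => f t ^+ n).
Proof.
move=> bf; elim: n => [|n IHn]; first exact: bounded_measurable_cst.
have := bounded_measurableM bf IHn.
by congr bounded_measurable; apply/funext => t; rewrite exprS.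
Qed.

Lemma bounded_measurable_sum D n (F : 'I_n -> T -> R) :
  (forall i, bounded_measurable D (F i)) ->
  bounded_measurable D (fun t => \sum_(i < n) F i t).
Proof.
elim: n F => [|n IHn] F bF.
  have := bounded_measurable_cst D 0.
  by congr bounded_measurable; apply/funext => t; rewrite big_ord0.
have := bounded_measurableD (IHn (fun i => F (widen_ord (leqnSn n) i))
  (fun i => bF _)) (bF ord_max).
by congr bounded_measurable; apply/funext => t; rewrite big_ord_recr.
Qed.

Lemma bounded_measurable_poly D f (p : {poly R}) : bounded_measurable D f ->
  bounded_measurable D (fun t => p.[f t]).
Proof.
move=> bf; have : bounded_measurable D (fun t => \sum_(i < size p) p`_i * f t ^+ i).
  apply: bounded_measurable_sum => i; apply: bounded_measurableM.
    exact: bounded_measurable_cst.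
  exact: bounded_measurableX.
by congr bounded_measurable; apply/funext => t; rewrite horner_coef.
Qed.

End BoundedMeasurable.

Section IntegralBoundedMeasurable.
Context d (T : measurableType d) (R : realType) (mu : {measure set T -> \bar R}).
Variable D : set T.
Hypotheses (mD : measurable D) (Dfin : (mu D < +oo)%E).
Implicit Types f g : T -> R.

Lemma integrable_bounded_measurable f : bounded_measurable D f ->
  mu.-integrable D (EFin \o f).
Proof.
move=> [mf [M fM]]; apply: measurable_bounded_integrable => //.
exists M; split; rewrite ?num_real // => N MN t Dt /=.
by rewrite (le_trans (fM _ Dt))// ltW.
Qed.

Lemma Rintegral_sum_bounded n (F : 'I_n -> T -> R) :
  (forall i, bounded_measurable D (F i)) ->
  \int[mu]_(t in D) (\sum_(i < n) F i t) = \sum_(i < n) \int[mu]_(t in D) F i t.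
Proof.
elim: n F => [|n IHn] F bF.
  under eq_Rintegral do rewrite big_ord0.
  by rewrite big_ord0 Rintegral_cst// mul0r.
under eq_Rintegral do rewrite big_ord_recr.
rewrite RintegralD//; last 2 first.
- exact/integrable_bounded_measurable/bounded_measurable_sum.
- exact/integrable_bounded_measurable.
by rewrite IHn// big_ord_recr.
Qed.

Lemma RintegralZl_bounded f r : bounded_measurable D f ->
  \int[mu]_(t in D) (r * f t) = r * \int[mu]_(t in D) f t.
Proof. by move=> bf; rewrite RintegralZl//; exact: integrable_bounded_measurable. Qed.

Lemma RintegralD_bounded f g : bounded_measurable D f -> bounded_measurable D g ->
  \int[mu]_(t in D) (f t + g t) = \int[mu]_(t in D) f t + \int[mu]_(t in D) g t.
Proof. by move=> bf bg; rewrite RintegralD//; exact: integrable_bounded_measurable. Qed.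

Lemma RintegralB_bounded f g : bounded_measurable D f -> bounded_measurable D g ->
  \int[mu]_(t in D) (f t - g t) = \int[mu]_(t in D) f t - \int[mu]_(t in D) g t.
Proof. by move=> bf bg; rewrite RintegralB//; exact: integrable_bounded_measurable. Qed.

Lemma Rintegral_horner_mul f g (p : {poly R}) :
  bounded_measurable D f -> bounded_measurable D g ->
  \int[mu]_(t in D) (p.[f t] * g t) =
  \sum_(i < size p) p`_i * \int[mu]_(t in D) (f t ^+ i * g t).
Proof.
move=> bf bg.
have bm i : bounded_measurable D (fun t => f t ^+ i * g t).
  by apply: bounded_measurableM => //; exact: bounded_measurableX.
have bmZ i : bounded_measurable D (fun t => p`_i * (f t ^+ i * g t)).
  by apply: bounded_measurableM => //; exact: bounded_measurable_cst.
under eq_Rintegral => t _.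
  rewrite horner_coef mulr_suml; under eq_bigr do rewrite -mulrA; over.
rewrite Rintegral_sum_bounded//.
by apply: eq_bigr => i _; rewrite RintegralZl_bounded.
Qed.

Section Orthonormal.
Variables (e : nat -> T -> R).
Hypotheses (be : forall j, bounded_measurable D (e j))
  (oe : forall j k, \int[mu]_(t in D) (e j t * e k t) = (j == k)%:R).

Lemma bounded_measurable_lincomb n (c : nat -> R) :
  bounded_measurable D (fun t => \sum_(j < n) c j * e j t).
Proof.
apply: bounded_measurable_sum => j; apply: bounded_measurableM => //.
exact: bounded_measurable_cst.
Qed.

Lemma Rintegral_mul_lincomb f n (c : nat -> R) : bounded_measurable D f ->
  \int[mu]_(t in D) (f t * \sum_(j < n) c j * e j t) =
  \sum_(j < n) c j * \int[mu]_(t in D) (e j t * f t).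
Proof.
move=> bf; have bm j : bounded_measurable D (fun t => e j t * f t).
  exact: bounded_measurableM.
under eq_Rintegral => t _.
  rewrite mulr_sumr; under eq_bigr do rewrite mulrCA [f t * _]mulrC; over.
rewrite Rintegral_sum_bounded; last first.
  by move=> j; apply: bounded_measurableM => //; exact: bounded_measurable_cst.
by apply: eq_bigr => j _; rewrite RintegralZl_bounded.
Qed.

Lemma Rintegral_coord n (c : nat -> R) k : (k < n)%N ->
  \int[mu]_(t in D) (e k t * \sum_(j < n) c j * e j t) = c k.
Proof.
move=> kn; rewrite Rintegral_mul_lincomb//.
under eq_bigr do rewrite oe.
rewrite (bigD1 (Ordinal kn))//= eqxx mulr1 big1 ?addr0// => j jk.
rewrite (_ : (_ == k) = false) ?mulr0//.
by apply/negbTE; apply: contra jk => /eqP jk; exact/eqP/val_inj.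
Qed.

Lemma Rintegral_sqr_lincomb n (c : nat -> R) :
  \int[mu]_(t in D) (\sum_(j < n) c j * e j t) ^+ 2 = \sum_(j < n) c j ^+ 2.
Proof.
rewrite Rintegral_mul_lincomb; last exact: bounded_measurable_lincomb.
by apply: eq_bigr => j _; rewrite Rintegral_coord.
Qed.

(** Pythagoras, in the one form that yields all the others: the coefficients [a]
    of [f] make the last sum vanish, which gives Bessel's inequality and the exact
    error of a partial sum, and any other choice of [c] makes the distance to [f]
    larger, which gives the best approximation property. *)
Lemma Rintegral_sqr_sub_lincomb f n (c : nat -> R) : bounded_measurable D f ->
  let a j := \int[mu]_(t in D) (e j t * f t) in
  \int[mu]_(t in D) (f t - \sum_(j < n) c j * e j t) ^+ 2 =
  \int[mu]_(t in D) f t ^+ 2 - \sum_(j < n) a j ^+ 2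
  + \sum_(j < n) (c j - a j) ^+ 2.
Proof.
move=> bf a; pose s t := \sum_(j < n) c j * e j t.
have bs : bounded_measurable D s by exact: bounded_measurable_lincomb.
have bf2 := bounded_measurableX 2 bf; have bs2 := bounded_measurableX 2 bs.
have bfs : bounded_measurable D (fun t => 2 * (f t * s t)).
  apply: bounded_measurableM; first exact: bounded_measurable_cst.
  exact: bounded_measurableM.
transitivity (\int[mu]_(t in D) (f t ^+ 2 - 2 * (f t * s t) + s t ^+ 2)).
  by apply: eq_Rintegral => t _; rewrite -/(s t) /=; ring.
rewrite RintegralD_bounded//; last exact: bounded_measurableB.
rewrite RintegralB_bounded// RintegralZl_bounded; last exact: bounded_measurableM.
rewrite Rintegral_mul_lincomb// Rintegral_sqr_lincomb -!addrA; congr (_ + _).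
rewrite mulr_sumr -!sumrN -!big_split/=.
by apply: eq_bigr => j _; rewrite -/(a j); ring.
Qed.

Lemma bessel f n : bounded_measurable D f ->
  \sum_(j < n) (\int[mu]_(t in D) (e j t * f t)) ^+ 2 <=
  \int[mu]_(t in D) f t ^+ 2.
Proof.
move=> bf; rewrite -subr_ge0; set a := fun j => \int[mu]_(t in D) (e j t * f t).
have := Rintegral_sqr_sub_lincomb n a bf.
rewrite /= -/a [X in _ = _ + X]big1 ?addr0; last by move=> j _; rewrite subrr expr0n.
by move=> <-; apply: Rintegral_ge0 => t _; exact: sqr_ge0.
Qed.

End Orthonormal.

End IntegralBoundedMeasurable.

(** * Density of the polynomials in $L_2([0,1])$ *)

Section Bernstein.
Context (R : realType).

(** The Bernstein polynomial $\sum_k \phi(k) \binom{n}{k} t^k (1-t)^{n-k}$, that is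
    the mean of $\phi$ under the binomial law of parameters $n$ and $t$, defined
    by conditioning on the first toss: this turns the estimates below into
    inductions that involve no binomial coefficient. *)
Fixpoint bernstein n (phi : nat -> R) : {poly R} :=
  if n is m.+1 then
    'X * bernstein m (fun k => phi k.+1) + (1 - 'X) * bernstein m phi
  else (phi 0%N)%:P.

(** Chebyshev's argument. A binomial variable $K$ satisfies
    $E(K-u)^2 = n t(1-t) + (nt-u)^2$, so a quadratic bound on $\phi$ passes to its
    mean; $u$ is arbitrary because the first toss shifts it by one. *)
Lemma bernstein_le n (phi : nat -> R) (a b c u t : R) : 0 <= t <= 1 ->
  (forall k, (k <= n)%N -> `|phi k - c| <= a + b * (k%:R - u) ^+ 2) ->
  `|(bernstein n phi).[t] - c| <=
  a + b * (n%:R * (t * (1 - t)) + (n%:R * t - u) ^+ 2).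
Proof.
move=> /andP[t0 t1]; elim: n phi u => [|n IHn] phi u phic.
  by rewrite /= hornerC !mul0r add0r; exact: phic.
have hE : (bernstein n.+1 phi).[t] = t * (bernstein n (fun k => phi k.+1)).[t]
    + (1 - t) * (bernstein n phi).[t] by rewrite /= !hornerE.
rewrite hE.
have -> : t * (bernstein n (fun k => phi k.+1)).[t]
    + (1 - t) * (bernstein n phi).[t] - c
  = t * ((bernstein n (fun k => phi k.+1)).[t] - c)
    + (1 - t) * ((bernstein n phi).[t] - c) by ring.
apply: le_trans (ler_normD _ _) _.
rewrite !normrM (ger0_norm t0) (@ger0_norm _ (1 - t)) ?subr_ge0//.
have -> : a + b * (n.+1%:R * (t * (1 - t)) + (n.+1%:R * t - u) ^+ 2)
  = t * (a + b * (n%:R * (t * (1 - t)) + (n%:R * t - (u - 1)) ^+ 2))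
  + (1 - t) * (a + b * (n%:R * (t * (1 - t)) + (n%:R * t - u) ^+ 2)).
  by rewrite -[in LHS]natr1; ring.
apply: lerD; apply: ler_wpM2l; rewrite ?subr_ge0//; apply: IHn => k kn.
  have -> : k%:R - (u - 1) = k.+1%:R - u by rewrite -natr1; ring.
  exact: phic.
by apply: phic; exact: ltnW.
Qed.

Definition bernstein_approx (h : R -> R) n : {poly R} :=
  bernstein n (fun k => h (k%:R / n%:R)).

Lemma bernstein_approx_bound h M n (t : R) : (forall s, `|h s| <= M) ->
  0 <= t <= 1 -> `|(bernstein_approx h n).[t]| <= M.
Proof.
move=> hM t01; have := @bernstein_le n (fun k => h (k%:R / n%:R)) M 0 0 0 t t01.
by rewrite !mul0r addr0 subr0; apply => k kn; rewrite !subr0 mul0r addr0.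
Qed.

(** Near [t] continuity bounds $|h(k/n)-h(t)|$ by $\epsilon/2$; away from [t],
    where $|k/n-t|\ge\delta$, the trivial bound $2M$ is at most
    $2M\delta^{-2}(k/n-t)^2$. The sum of the two is a quadratic bound, whose mean
    is $\epsilon/2 + O(1/n)$. *)
Lemma bernstein_approx_cvg h M (t : R) : (forall s, `|h s| <= M) ->
  {for t, continuous h} -> 0 <= t <= 1 ->
  (bernstein_approx h n).[t] @[n --> \oo] --> h t.
Proof.
move=> hM ch t01; have M0 : 0 <= M by apply: le_trans (hM 0).
apply/cvgrPdist_le => eps eps0.
have /cvgrPdist_le/(_ (eps / 2)) := ch; rewrite divr_gt0// => /(_ isT).
move=> [del /= del0 hdel].
pose b := 2 * M / del ^+ 2.
have b0 : 0 <= b by rewrite divr_ge0 ?sqr_ge0 ?mulr_ge0.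
have bE : b * del ^+ 2 = 2 * M by rewrite divfK// gt_eqF// exprn_gt0.
clearbody b.
have key n : (0 < n)%N ->
    `|h t - (bernstein_approx h n).[t]| <= eps / 2 + b / n%:R.
  move=> n0; have nR : 0 < n%:R :> R by rewrite ltr0n.
  rewrite distrC; apply: le_trans (_ : _ <= eps / 2 + b / n%:R ^+ 2 *
      (n%:R * (t * (1 - t)) + (n%:R * t - n%:R * t) ^+ 2)) _.
    apply: bernstein_le => // k kn.
    have -> : b / n%:R ^+ 2 * (k%:R - n%:R * t) ^+ 2 = b * (k%:R / n%:R - t) ^+ 2.
      by field; rewrite gt_eqF.
    have [kt|kt] := ltP `|t - k%:R / n%:R| del.
      rewrite distrC; apply: le_trans (hdel _ kt) _.
      by rewrite lerDl mulr_ge0// sqr_ge0.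
    apply: le_trans (_ : 2 * M <= _).
      apply: le_trans (ler_normB _ _) _; (have -> : 2 * M = M + M by ring); exact: lerD.
    rewrite -bE -[leLHS]add0r; apply: lerD; first by rewrite divr_ge0// ltW.
    rewrite ler_wpM2l// -[leRHS]real_normK ?num_real// distrC.
    by rewrite ler_sqr// nnegrE// ltW.
  rewrite subrr expr0n addr0 lerD2l.
  have -> : b / n%:R ^+ 2 * (n%:R * (t * (1 - t))) = b / n%:R * (t * (1 - t)).
    by field; rewrite gt_eqF.
  rewrite -[leRHS]mulr1 ler_wpM2l ?divr_ge0//.
  by case/andP: t01 => t0 t1; nra.
near=> n; have n0 : (0 < n)%N by near: n; exact: nbhs_infty_gt.
apply: le_trans (key n n0) _; rewrite [leRHS]splitr lerD2l.
rewrite ler_pdivrMr ?ltr0n// -ler_pdivrMl ?divr_gt0//.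
by near: n; exact: nbhs_infty_ger.
Unshelve. all: by end_near. Qed.

End Bernstein.

Section PolynomialDensity.
Context (R : realType).
Local Notation leb := (@lebesgue_measure R).

Lemma lebesgue_measure_I01 : leb I01 = 1%E.
Proof. by rewrite /I01 lebesgue_measure_itv/= lte_fin ltr01 oppr0 adde0. Qed.

Lemma lebesgue_measure_I01_fin : (leb I01 < +oo)%E.
Proof. by rewrite lebesgue_measure_I01 ltry. Qed.

Lemma bounded_measurable_I01_id :
  @bounded_measurable _ (measurableTypeR R) R I01 id.
Proof.
split; first exact: measurable_id.
exists 1 => t; rewrite /I01/= in_itv/= => /andP[t0 t1].
by rewrite ger0_norm.
Qed.

Lemma bounded_measurable_horner (p : {poly R}) :
  @bounded_measurable _ (measurableTypeR R) R I01 (horner p).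
Proof. exact: bounded_measurable_poly bounded_measurable_I01_id. Qed.

Definition clip (a b y : R) : R := Num.max a (Num.min b y).

Lemma clip_itv a b y : a <= b -> a <= clip a b y <= b.
Proof. by move=> ab; rewrite /clip le_max lexx ge_max ab ge_min lexx. Qed.

Lemma clip_id a b y : a <= y <= b -> clip a b y = y.
Proof. by move=> /andP[ay yb]; rewrite /clip (min_idPr yb) (max_idPr ay). Qed.

Lemma clip_lipschitz a b y z : `|clip a b y - clip a b z| <= `|y - z|.
Proof.
have le1 := ler_norm (y - z); have le2 := ler_norm (z - y).
rewrite [X in _ <= X]distrC in le2; rewrite ler_norml /clip /Num.max /Num.min.
by do 4 case: ifPn; rewrite -?leNgt => *; apply/andP; split; lra.
Qed.

(** The Bernstein approximations share the bound of [h], so pointwise convergence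
    is enough, by dominated convergence. *)
Lemma cvg_Rintegral_bernstein (h : R -> R) M : (forall s, `|h s| <= M) ->
  continuous h ->
  (\int[leb]_(t in I01) (h t - (bernstein_approx h n).[t]) ^+ 2) @[n --> \oo]
    --> (0 : R).
Proof.
move=> hM ch.
have mI := @measurable_I01 R.
have mh : measurable_fun (I01 : set (measurableTypeR R)) h.
  by apply: measurable_funTS; exact: continuous_measurable_fun.
have bh : bounded_measurable (I01 : set (measurableTypeR R)) h by split=> //; exists M.
pose f_ n (t : R) := ((h t - (bernstein_approx h n).[t]) ^+ 2)%:E.
have bf n : bounded_measurable (I01 : set (measurableTypeR R))
    (fun t => (h t - (bernstein_approx h n).[t]) ^+ 2).
  apply: bounded_measurableX; apply: bounded_measurableB => //.
  exact: bounded_measurable_horner.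
have [] := @dominated_convergence _ (measurableTypeR R) R leb I01 mI f_
    (cst 0%E) (fun=> ((M + M) ^+ 2)%:E).
- move=> n; apply/measurable_EFinP; exact: (bf n).1.
- exact: measurable_cst.
- apply: aeW => t; rewrite /I01/= in_itv/= => t01.
  rewrite /f_; apply: cvg_EFin; first exact: nearW.
  have cB : h t - (bernstein_approx h n).[t] @[n --> \oo] --> h t - h t.
    by apply: cvgB; [exact: cvg_cst|exact: (bernstein_approx_cvg hM (ch t) t01)].
  have := cvgM cB cB; rewrite subrr mulr0. exact.
- apply: (integrable_bounded_measurable mI lebesgue_measure_I01_fin).
  exact: bounded_measurable_cst.
- apply: aeW => t n; rewrite /I01/= in_itv/= => t01.
  rewrite /f_ lee_fin ger0_norm ?sqr_ge0//.
  rewrite -real_normK ?num_real// lerXn2r ?nnegrE//.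
    by rewrite addr_ge0// (le_trans _ (hM 0)).
  by rewrite (le_trans (ler_normB _ _))// lerD// bernstein_approx_bound.
move=> _ _; rewrite integral0 => /fine_cvg; exact.
Qed.

(** Continuous functions are dense in $L_1$. Clipping the approximant to the range
    of [x] brings it closer to [x] and makes both functions bounded by $M$, so that
    the $L_2$ distance squared is at most $2M$ times the $L_1$ distance; the
    clipped function is in turn approximated by its Bernstein polynomials. *)
Lemma polynomial_dense (x : R -> R) (eps : R) :
  bounded_measurable (I01 : set (measurableTypeR R)) x -> 0 < eps ->
  exists p : {poly R}, \int[leb]_(t in I01) (x t - p.[t]) ^+ 2 <= eps.
Proof.
have final (e a b : R) : a <= e / 4 -> b <= e / 4 -> 2 * a + 2 * b <= e by lra.
have young (a b c : R) : (a - c) ^+ 2 <= 2 * (a - b) ^+ 2 + 2 * (b - c) ^+ 2.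
  by have := sqr_ge0 (a - b - (b - c)); nra.
move=> bx eps0; have [mx [M0 xM0]] := bx.
have mI := @measurable_I01 R; have If := lebesgue_measure_I01_fin.
pose M := Num.max 1 M0; have M1 : 1 <= M by rewrite le_max lexx.
have xM t : I01 t -> `|x t| <= M by move=> /xM0; rewrite le_max => ->; rewrite orbT.
have M0' : 0 < M by apply: lt_le_trans M1.
clearbody M.
have ix := integrable_bounded_measurable mI If bx.
have [g_ [cg ig cvg0]] := approximation_continuous_integrable mI If ix.
have /fine_cvg/cvgrPdist_le/(_ (eps / (8 * M))) := cvg0.
rewrite divr_gt0 ?mulr_gt0// => /(_ isT) [n _ /(_ n (leqnn n))].
rewrite /= sub0r normrN.
set J := fine _ => Jle.
pose h t := clip (- M) M (g_ n t).
have NMM : - M <= M by lra.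
have hM s : `|h s| <= M by rewrite ler_norml clip_itv.
have ch : continuous h.
  move=> t; apply/cvgrPdist_le => e e0; have /cvgrPdist_le/(_ e e0) := cg n t.
  by apply: filterS => s; apply: le_trans; exact: clip_lipschitz.
have mh : measurable_fun (I01 : set (measurableTypeR R)) h.
  by apply: measurable_funTS; exact: continuous_measurable_fun.
have bh : bounded_measurable (I01 : set (measurableTypeR R)) h by split=> //; exists M.
have xh : \int[leb]_(t in I01) (x t - h t) ^+ 2 <= eps / 4.
  have igx : leb.-integrable I01 (EFin \o (fun t => `|x t - g_ n t|)).
    apply: (@integrable_abse _ _ _ leb I01 (fun t => (x t - g_ n t)%:E)).
    by under eq_fun do rewrite EFinB; exact: integrableB (ig n).
  apply: le_trans (_ : 2 * M * J <= _); last first.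
    move: Jle; move=> /(le_trans (ler_norm _)) Jle.
    have -> : eps / 4 = 2 * M * (eps / (8 * M)) by field; rewrite gt_eqF.
    by rewrite ler_wpM2l// mulr_ge0// ltW.
  rewrite -RintegralZl//; apply: le_Rintegral => //.
  - apply: integrable_bounded_measurable => //.
    by apply: bounded_measurableX; exact: bounded_measurableB.
  - have -> : EFin \o (fun t => 2 * M * `|x t - g_ n t|) =
        (fun t => (2 * M)%:E * (EFin \o (fun t => `|x t - g_ n t|%R)) t)%E.
      by apply/funext => t; rewrite /= EFinM.
    exact: integrableZl.
  - move=> t It; rewrite -real_normK ?num_real// expr2.
    apply: ler_pM => //.
      by have := xM t It; have := hM t; rewrite !ler_norml => /andP[? ?] /andP[? ?];
        apply/andP; split; lra.
    rewrite -{1}(@clip_id (- M) M (x t)) ?clip_lipschitz// -ler_norml.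
    exact: xM.
have /cvgrPdist_le/(_ (eps / 4)) := cvg_Rintegral_bernstein hM ch.
rewrite divr_gt0// => /(_ isT) [m _ /(_ m (leqnn m))] /=.
rewrite sub0r normrN => /(le_trans (ler_norm _)).
set p := bernstein_approx h m => hp; exists p.
have bp := bounded_measurable_horner p.
have bxh : bounded_measurable (I01 : set (measurableTypeR R))
    (fun t => 2 * (x t - h t) ^+ 2).
  apply: bounded_measurableM; first exact: bounded_measurable_cst.
  by apply: bounded_measurableX; exact: bounded_measurableB.
have bhp : bounded_measurable (I01 : set (measurableTypeR R))
    (fun t => 2 * (h t - p.[t]) ^+ 2).
  apply: bounded_measurableM; first exact: bounded_measurable_cst.
  by apply: bounded_measurableX; exact: bounded_measurableB.
apply: le_trans (_ : \int[leb]_(t in I01)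
    (2 * (x t - h t) ^+ 2 + 2 * (h t - p.[t]) ^+ 2) <= _).
  apply: le_Rintegral => //.
  - apply: integrable_bounded_measurable => //.
    by apply: bounded_measurableX; exact: bounded_measurableB.
  - by apply: integrable_bounded_measurable => //; exact: bounded_measurableD.
rewrite RintegralD_bounded// !RintegralZl_bounded//; first exact: final xh hp.
  by apply: bounded_measurableX; exact: bounded_measurableB.
by apply: bounded_measurableX; exact: bounded_measurableB.
Qed.

End PolynomialDensity.

(** * Legendre coefficients and convergence in $\ell^2$ *)

Section L2Norm.
Context (R : realType).
Implicit Types c : nat -> R.

Lemma l2normE c :
  l2norm c = ((\sum_(0 <= k <oo) (c k ^+ 2)%:E) `^ 2^-1)%E.
Proof.
rewrite /l2norm Lnorm_counting//; congr (_ `^ _)%E.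
apply: eq_eseriesr => k _ /=.
by rewrite powR_mulrn// real_normK ?num_real.
Qed.

Lemma l2norm_le c (B : R) : (forall n, \sum_(j < n) c j ^+ 2 <= B) ->
  (l2norm c <= (Num.sqrt B)%:E)%E.
Proof.
move=> cB; have B0 : 0 <= B by have := cB 0%N; rewrite big_ord0.
rewrite l2normE -powR12_sqrt// -poweR_EFin.
have ge0 k : (0 <= (c k ^+ 2)%:E)%E by rewrite lee_fin sqr_ge0.
apply: gt0_ler_poweR; rewrite ?invr_ge0// ?in_itv/= ?andbT ?leey ?lee_fin ?B0//.
  by rewrite nneseries_ge0.
apply: lime_le; first exact: is_cvg_nneseries.
by apply: nearW => n; rewrite big_mkord sumEFin lee_fin.
Qed.

Lemma abs_le_l2norm c k : (`|c k|%:E <= l2norm c)%E.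
Proof.
have ge0 n : (0 <= (c n ^+ 2)%:E)%E by rewrite lee_fin sqr_ge0.
rewrite l2normE -sqrtr_sqr -powR12_sqrt ?sqr_ge0// -poweR_EFin.
apply: gt0_ler_poweR; rewrite ?invr_ge0// ?in_itv/= ?andbT ?leey ?ge0//.
  by rewrite nneseries_ge0.
apply: le_trans (nneseries_lim_ge k.+1 _); last by [].
rewrite big_mkord sumEFin lee_fin big_ord_recr/= lerDr.
by rewrite sumr_ge0// => i _; exact: sqr_ge0.
Qed.

Lemma cvg_l2_coord (u : nat -> nat -> R) c k : cvg_l2 u c ->
  u n k @[n --> \oo] --> c k.
Proof.
move=> [_ uc]; apply/cvgrPdist_le => eps eps0.
have /fine_cvgP[ufin /cvgrPdist_le/(_ _ eps0)] := uc.
apply: filterS2 ufin => n ufin /=; rewrite sub0r normrN => uleps.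
rewrite distrC -lee_fin; apply: le_trans (abs_le_l2norm (fun j => u n j - c j) k) _.
by rewrite -(fineK ufin) lee_fin (le_trans (ler_norm _)).
Qed.

Lemma cvg_l2_sqrt (u : nat -> nat -> R) c (B : nat -> R) :
  (l2norm c < +oo)%E ->
  (forall n N, \sum_(j < N) (u n j - c j) ^+ 2 <= B n) ->
  B n @[n --> \oo] --> (0 : R) -> cvg_l2 u c.
Proof.
move=> cfin uB B0; split => //.
apply: (@squeeze_cvge _ _ _ _ (fun=> 0%E) _ (fun n => (Num.sqrt (B n))%:E)).
- by apply: nearW => n; rewrite Lnorm_ge0 l2norm_le.
- exact: cvg_cst.
- apply: cvg_EFin; first exact: nearW.
  by have := cvg_comp _ _ B0 (@sqrt_continuous R 0); rewrite sqrtr0; exact.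
Qed.

End L2Norm.

Section LegendreSeries.
Context (R : realType) (L : nat -> {poly R}).
Hypothesis legL : shifted_legendre L.
Local Notation leb := (@lebesgue_measure R).
Local Notation bm := (@bounded_measurable _ (measurableTypeR R) R I01).

Let mI := @measurable_I01 R.
Let Ifin := @lebesgue_measure_I01_fin R.
Let sizeL : forall j, size (L j) = j.+1.
Proof. by have [] := legL. Qed.
Let bL j : bm (horner (L j)).
Proof. exact: bounded_measurable_horner. Qed.
Let oL : forall j k, \int[leb]_(t in I01) ((L j).[t] * (L k).[t]) = (j == k)%:R.
Proof. by have [] := legL. Qed.

Lemma horner_legendre_sum n (a : nat -> R) t :
  (legendre_sum L n a).[t] = \sum_(j < n.+1) a j * (L j).[t].
Proof. by rewrite /legendre_sum horner_sum; apply: eq_bigr => j _; rewrite hornerZ. Qed.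

Lemma size_legendre_sum n (a : nat -> R) : (size (legendre_sum L n a) <= n.+1)%N.
Proof.
apply: (leq_trans (size_sum _ _ _)); apply/bigmax_leqP => j _.
by rewrite (leq_trans (size_scale_leq _ _))// sizeL ltnS -ltnS.
Qed.

Lemma size_legendre_sum_exp n k (a : nat -> R) :
  (size (legendre_sum L n a ^+ k) <= (k * n).+1)%N.
Proof.
apply: leq_trans (size_poly_exp_leq _ _) _; rewrite ltnS mulnC leq_mul2l.
by rewrite -[(size _).-1]subn1 leq_subLR add1n size_legendre_sum orbT.
Qed.

Lemma legendre_sum_coord n (p : {poly R}) : (size p <= n.+1)%N ->
  legendre_sum L n (legendre_coord L n p) = p.
Proof. by move=> sp; have [] := legendre_coordP sizeL sp. Qed.

(** Coordinates in the Legendre basis are Fourier coefficients; for [k > n] both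
    sides vanish, which is why [p] is expanded up to degree [k] in that case. *)
Lemma legendre_coord_fourier n (p : {poly R}) k : (size p <= n.+1)%N ->
  legendre_coord L n p k = fourier_legendre L (horner p) k.
Proof.
move=> sp; have [pE c0] := legendre_coordP sizeL sp.
rewrite /fourier_legendre; set c := legendre_coord L n p in pE c0 *.
have [kn|nk] := ltnP k n.+1.
  rewrite -[LHS](Rintegral_coord mI Ifin bL oL c kn).
  by apply: eq_Rintegral => t _; rewrite [in RHS]pE horner_legendre_sum.
rewrite c0//; transitivity (\int[leb]_(t in I01)
    ((L k).[t] * \sum_(j < k.+1) c j * (L j).[t])).
  by rewrite (Rintegral_coord mI Ifin bL oL c (ltnSn k)) c0.
apply: eq_Rintegral => t _; rewrite pE horner_legendre_sum; congr (_ * _).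
rewrite -!(big_mkord xpredT (fun j => c j * (L j).[t])).
rewrite (big_cat_nat (leq0n n.+1)) ?(leqW nk)//=.
rewrite [X in _ + X]big_nat_cond [X in _ + X]big1 ?addr0// => j /andP[/andP[nj _] _].
by rewrite c0// mul0r.
Qed.

Lemma fourier_legendreB (f g : R -> R) j : bm f -> bm g ->
  fourier_legendre L (fun t => f t - g t) j =
  fourier_legendre L f j - fourier_legendre L g j.
Proof.
move=> bf bg; rewrite /fourier_legendre -RintegralB_bounded//.
- by apply: eq_Rintegral => t _; rewrite mulrBr.
- exact: bounded_measurableM.
- exact: bounded_measurableM.
Qed.

Lemma l2norm_fourier_fin f : bm f -> (l2norm (fourier_legendre L f) < +oo)%E.
Proof.
move=> bf; set B := \int[leb]_(t in I01) f t ^+ 2.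
apply: (@le_lt_trans _ _ (Num.sqrt B)%:E); last exact: ltry.
by apply: l2norm_le => n; exact: (bessel mI Ifin bL oL).
Qed.

(** By Bessel's inequality, the $\ell^2$ distance between Legendre coefficients is at
    most the $L_2$ distance between functions. *)
Lemma cvg_l2_legendre_coord (f : R -> R) (m : nat -> nat) (p : nat -> {poly R}) :
  bm f -> (forall n, (size (p n) <= (m n).+1)%N) ->
  \int[leb]_(t in I01) ((p n).[t] - f t) ^+ 2 @[n --> \oo] --> (0 : R) ->
  cvg_l2 (fun n => legendre_coord L (m n) (p n)) (fourier_legendre L f).
Proof.
move=> bf sp pf; apply: cvg_l2_sqrt pf; first exact: l2norm_fourier_fin.
move=> n N; have bp := bounded_measurable_horner (p n).
have bpf := bounded_measurableB bp bf.
under eq_bigr do rewrite legendre_coord_fourier// -fourier_legendreB//.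
exact: (bessel mI Ifin bL oL).
Qed.

(** The partial sum of order [n] is the best approximation of [x] in degree at most
    [n], so the density of the polynomials suffices. *)
Lemma legendre_series_cvg (x : R -> R) : bm x ->
  \int[leb]_(t in I01) ((legendre_sum L n (fourier_legendre L x)).[t] - x t) ^+ 2
    @[n --> \oo] --> (0 : R).
Proof.
move=> bx; apply/cvgrPdist_le => eps eps0.
have [p hp] := polynomial_dense bx eps0.
exists (size p) => // n /= pn; rewrite sub0r normrN ger0_norm; last first.
  by apply: Rintegral_ge0 => t _; exact: sqr_ge0.
apply: le_trans hp; have sp : (size p <= n.+1)%N by exact: leqW.
set a := fourier_legendre L x.
have := Rintegral_sqr_sub_lincomb mI Ifin bL oL n.+1 a bx.
rewrite /= -/(fourier_legendre L x) -/a [X in _ = _ + X -> _]big1; last first.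
  by move=> j _; rewrite -/(fourier_legendre L x j) -/(a j) subrr expr0n.
have := Rintegral_sqr_sub_lincomb mI Ifin bL oL n.+1 (legendre_coord L n p) bx.
rewrite /= => pE sE.
under eq_Rintegral do rewrite horner_legendre_sum -sqrrN opprB.
rewrite sE addr0; under [leRHS]eq_Rintegral do
  rewrite -{1}(legendre_sum_coord sp) horner_legendre_sum.
by rewrite pE lerDl sumr_ge0// => j _; exact: sqr_ge0.
Qed.

(** The coefficients of $s_n^{k-1}$ give back $s_n^{k-1}$, so the product that defines
    $a^{(k-1)} \star a$ is $s_n^k$: the star product and the power have the same
    approximating sequence. *)
Lemma is_star_conv_pow k (b a c : nat -> R) : (0 < k)%N ->
  is_conv_pow L k.-1 a b -> is_conv_pow L k a c -> is_star L k b a c.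
Proof.
case: k => // k _ ab ac; split => //.
move: ac; congr cvg_l2; apply/funext => n; rewrite /trunc_pow; congr legendre_coord.
by rewrite legendre_sum_coord ?exprSr// size_legendre_sum_exp.
Qed.

End LegendreSeries.

(** * Uniformly bounded partial sums: the power identities *)

Section AlmostEverywhere.
Context d (T : measurableType d) (R : realType) (mu : {measure set T -> \bar R}).
Variable D : set T.
Hypotheses (mD : measurable D) (Dfin : (mu D < +oo)%E).

Lemma ae_ge0_le_Rintegral (f g : T -> R) :
  bounded_measurable D f -> bounded_measurable D g ->
  (forall t, D t -> 0 <= f t) -> (forall t, D t -> 0 <= g t) ->
  {ae mu, forall t, D t -> f t <= g t} ->
  \int[mu]_(t in D) f t <= \int[mu]_(t in D) g t.
Proof.
move=> bf bg f0 g0 fg; apply: fine_le.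
- exact/integrable_fin_num/integrable_bounded_measurable.
- exact/integrable_fin_num/integrable_bounded_measurable.
- apply: ae_ge0_le_integral => //; apply/measurable_EFinP.
  + exact: bf.1.
  + exact: bg.1.
Qed.

End AlmostEverywhere.

Section BoundedPartialSums.
Context (R : realType).
Local Notation leb := (@lebesgue_measure R).
Local Notation bm := (@bounded_measurable _ (measurableTypeR R) R I01).

Lemma sup_norm01_bound (f : nat -> R -> R) :
  (ereal_sup (range (fun n => sup_norm01 (f n))) < +oo)%E ->
  exists2 M, 1 <= M &
    forall n, {ae leb, forall t, I01 t -> `|f n t| <= M}.
Proof.
set S := ereal_sup _ => Sfin.
have leS n : (sup_norm01 (f n) <= S)%E.
  by apply: ereal_sup_ubound; exists n.
have S0 : (0 <= S)%E by apply: le_trans (leS 0%N); exact: Lnorm_ge0.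
have SE : S = (fine S)%:E by rewrite fineK// ge0_fin_numE.
exists (Num.max 1 (fine S)) => [|n]; first by rewrite le_max lexx.
have : (sup_norm01 (f n) <= (Num.max 1 (fine S))%:E)%E.
  by apply: le_trans (leS n) _; rewrite SE lee_fin le_max lexx orbT.
have I1 : lebesgue01 R setT = 1%E.
  by rewrite /lebesgue01 /= /mrestr setTI lebesgue_measure_I01.
rewrite /sup_norm01 unlock I1 lte01.
move=> /ess_supP[N [mN N0 subN]].
exists (N `&` I01); split => //; first exact: measurableI (@measurable_I01 R).
move=> t /= /not_implyP[It ftM]; split => //; apply: subN => /=.
by rewrite lee_fin.
Qed.

(** $u^i-v^i$ is $u-v$ times a sum of $i$ monomials of degree $i-1$; the exponent [i]
    instead of [i - 1] only spares a case analysis, as [1 <= M]. *)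
Lemma subrX_le (u v M : R) i : 1 <= M -> `|u| <= M -> `|v| <= M ->
  (u ^+ i - v ^+ i) ^+ 2 <= (i%:R * M ^+ i) ^+ 2 * (u - v) ^+ 2.
Proof.
move=> M1 uM vM; have M0 : 0 <= M by apply: le_trans M1.
rewrite -exprMn mulrC -[leLHS]real_normK ?num_real// -[leRHS]real_normK ?num_real//.
rewrite lerXn2r ?nnegrE// subrXX [leLHS]normrM [leRHS]normrM ler_wpM2l//.
rewrite [leRHS]ger0_norm ?mulr_ge0 ?exprn_ge0//.
apply: le_trans (ler_norm_sum _ _ _) _.
have -> : i%:R * M ^+ i = \sum_(k < i) M ^+ i.
  by rewrite sumr_const card_ord mulr_natl.
apply: ler_sum => k _; rewrite normrM !normrX.
apply: le_trans (_ : M ^+ (i.-1 - k) * M ^+ k <= _).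
  by rewrite ler_pM ?exprn_ge0// lerXn2r ?nnegrE.
rewrite -exprD ler_weXn2l// subnK ?leq_pred//.
by case: i k => [[]|i k] //=; rewrite -ltnS.
Qed.

Context (L : nat -> {poly R}).
Hypothesis legL : shifted_legendre L.

(** The partial sums $s_n$ converge to [x] in $L_2$. Since they and [x] have a common
    bound, $t\mapsto t^i$ is Lipschitz on the range of both, hence $s_n^i\to x^i$ in
    $L_2$, and so do the coefficients in $\ell^2$. *)
Lemma is_conv_pow_bounded (x : R -> R) (M : R) i : bm x -> 1 <= M ->
  (forall t, I01 t -> `|x t| <= M) ->
  (forall n, {ae leb, forall t, I01 t ->
     `|(legendre_sum L n (fourier_legendre L x)).[t]| <= M}) ->
  is_conv_pow L i (fourier_legendre L x) (fourier_pow L x i).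
Proof.
move=> bx M1 xM sM; set a := fourier_legendre L x.
have mI := @measurable_I01 R; have If := @lebesgue_measure_I01_fin R.
have bs n := bounded_measurable_horner (legendre_sum L n a).
apply: cvg_l2_legendre_coord => //.
- exact: bounded_measurableX.
- by move=> n; exact: size_legendre_sum_exp.
pose C := (i%:R * M ^+ i) ^+ 2.
apply: (@squeeze_cvgr _ _ _ _ (fun=> 0) (fun n => C *
    \int[leb]_(t in I01) ((legendre_sum L n a).[t] - x t) ^+ 2)).
- apply: nearW => n; apply/andP; split.
    by apply: Rintegral_ge0 => t _; exact: sqr_ge0.
  have bd : bm (fun t => ((legendre_sum L n a).[t] - x t) ^+ 2).
    exact/bounded_measurableX/bounded_measurableB.
  rewrite -(RintegralZl_bounded mI If)//.
  apply: ae_ge0_le_Rintegral => //.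
  + apply: bounded_measurableX; apply: bounded_measurableB.
      have := bounded_measurableX i (bs n).
      by congr bounded_measurable; apply/funext => t; rewrite horner_exp.
    exact: bounded_measurableX.
  + by apply: bounded_measurableM => //; exact: bounded_measurable_cst.
  + by move=> t _; exact: sqr_ge0.
  + by move=> t _; rewrite mulr_ge0 ?sqr_ge0.
  + apply: negligibleS (sM n) => t /= + sMt; apply => It; rewrite horner_exp.
    by apply: subrX_le => //; [exact: sMt|exact: xM].
- exact: cvg_cst.
- rewrite -[X in _ --> X](mulr0 C); apply: cvgM; first exact: cvg_cst.
  exact: legendre_series_cvg.
Qed.

Lemma power_identities_of_conv_pow (b : nat -> nat -> R) :
  (forall i, (0 < i)%N -> is_conv_pow L i (b 1%N) (b i)) ->
  power_identities L b.
Proof.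
move=> conv i; case: i => [|[|i]]// _; split; first exact: conv.
by apply: is_star_conv_pow => //; exact: conv.
Qed.

Lemma bounded_measurable_trajectory (x : R -> R) : trajectory x -> bm x.
Proof.
move=> [mx x01]; split => //; exists 1 => t /x01.
by rewrite /I01/= in_itv/= => /andP[x0 x1]; rewrite ger0_norm.
Qed.

Lemma identity_I_of_bounded_sums (x : R -> R) : trajectory x ->
  (ereal_sup (range (fun n : nat =>
     sup_norm01 (horner (legendre_sum L n (fourier_legendre L x))))) < +oo)%E ->
  identity_I L x.
Proof.
move=> tx /sup_norm01_bound[M M1 sM]; have bx := bounded_measurable_trajectory tx.
apply: power_identities_of_conv_pow => i _.
apply: (@is_conv_pow_bounded x M i) => // t /(tx.2).
by rewrite /I01/= in_itv/= => /andP[x0 x1]; rewrite ger0_norm// (le_trans x1).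
Qed.

End BoundedPartialSums.

(** * Measures supported on a trajectory *)

Section Trajectory.
Context (R : realType) (mu : probability (measurableTypeR R * measurableTypeR R)%type R).
Variable (x : R -> R).
Hypotheses (tx : trajectory x) (mux : supported_on_trajectory mu x).
Local Notation leb := (@lebesgue_measure R).
Local Notation sq := (I01 `*` I01 : set (measurableTypeR R * measurableTypeR R)).

(** Such a measure is the image of Lebesgue measure under $t\mapsto(x(t),t)$. As
    [x] is measurable on the unit interval only, it is extended by a constant
    first; this does not change the integral, because the second coordinate
    already confines $t$ to $[0,1]$. *)
Lemma integral_trajectory (f : measurableTypeR R * measurableTypeR R -> \bar R) :
  measurable_fun sq f -> (forall p, sq p -> (0 <= f p)%E) ->
  (\int[mu]_(p in sq) f p = \int[leb]_(t in I01) f (x t, t))%E.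
Proof.
move=> mf f0; have mI := @measurable_I01 R.
pose phi (t : measurableTypeR R) : measurableTypeR R * measurableTypeR R :=
  ((x \_ I01) t, t).
have mphi : measurable_fun setT phi.
  apply/measurable_fun_pair => //=.
  by case: (tx) => mx _; exact/(measurable_restrictT _ mI).
have phiI t : I01 t -> phi t = (x t, t).
  by move=> It; rewrite /phi patchE mem_set.
have phisq : phi @^-1` sq = I01.
  apply/seteqP; split => [t [_ ]//|t It]; rewrite -[_ t]/(sq (phi t)) phiI//.
  by split => //=; exact: tx.2.
pose phim := isMeasurableFun.Build _ _ _ _ phi mphi.
pose phi_ : {mfun _ >-> _} := HB.pack phi phim.
transitivity (\int[pushforward (lebesgue01 R) phi_]_(p in sq) f p)%E.
  apply: eq_measure_integral => A mA Asq; rewrite [LHS](mux mA).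
  have mphiA : measurable (phi @^-1` A).
    by rewrite -[X in measurable X]setTI; exact: (mphi measurableT _ mA).
  rewrite /pushforward.
  transitivity (\int[leb]_(t in I01) (\1_(phi @^-1` A) t)%:E)%E;
    last exact: integral_indic.
  apply: eq_integral => t; rewrite inE => It.
  rewrite diracE indicE mem_ysection -(phiI _ It).
  by congr ((_ : bool)%:R%:E); apply/idP/idP; rewrite !inE.
rewrite ge0_integral_pushforward//; last 2 first.
- exact: measurableX.
- by move=> p /set_mem; exact: f0.
rewrite phisq (eq_measure_integral leb); last first.
  by move=> A _ /setIidPl AI; rewrite /lebesgue01/= /mrestr AI.
by apply: eq_integral => t /set_mem It; rewrite /= phiI.
Qed.

End Trajectory.

(** * From mean square convergence to convergence almost everywhere *)

Section FastSubsequence.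
Context d (T : measurableType d) (R : realType) (mu : {measure set T -> \bar R}).
Variable D : set T.
Hypotheses (mD : measurable D) (Dfin : (mu D < +oo)%E).

Lemma nneseries_lty_cvg0 (u : nat -> R) : (forall k, 0 <= u k) ->
  (\sum_(0 <= k <oo) (u k)%:E)%E \is a fin_num -> u k @[k --> \oo] --> (0 : R).
Proof.
move=> u0 ufin; apply: cvg_series_cvg_0; apply: nondecreasing_is_cvgn.
  by apply/nondecreasing_seqP => n; rewrite /series/= big_nat_recr//= lerDl.
exists (fine (\sum_(0 <= k <oo) (u k)%:E)%E) => _ [n _ <-].
rewrite -lee_fin fineK// /series/= -sumEFin.
by apply: nneseries_lim_ge => k _ _; rewrite lee_fin.
Qed.

(** Along a subsequence whose mean square errors are at most $2^{-k}$, the sum of the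
    squared errors is integrable, hence finite almost everywhere, and its terms
    tend to $0$. *)
Lemma cvg_L2_subseq_ae (f : T -> R) (s : nat -> T -> R) :
  bounded_measurable D f -> (forall n, bounded_measurable D (s n)) ->
  \int[mu]_(t in D) (f t - s n t) ^+ 2 @[n --> \oo] --> (0 : R) ->
  exists phi : nat -> nat,
    {ae mu, forall t, D t -> s (phi k) t @[k --> \oo] --> f t}.
Proof.
move=> bf bs sf.
have ex k : exists n, \int[mu]_(t in D) (f t - s n t) ^+ 2 <= 2^-1 ^+ k.
  have k0 : 0 < 2^-1 ^+ k :> R by rewrite exprn_gt0.
  have /cvgrPdist_le/(_ _ k0)[n _ /(_ n (leqnn n))] := sf.
  by rewrite /= sub0r normrN => /(le_trans (ler_norm _)); exists n.
have [phi hphi] := choice ex; exists phi.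
pose g k t := (f t - s (phi k) t) ^+ 2.
have bg k : bounded_measurable D (g k).
  exact/bounded_measurableX/bounded_measurableB.
have g0 k t : 0 <= g k t by exact: sqr_ge0.
have geom n : \sum_(k < n) 2^-1 ^+ k <= 2 :> R.
  suff -> : \sum_(k < n) 2^-1 ^+ k = 2 - 2 * 2^-1 ^+ n :> R.
    by rewrite lerBlDr lerDl mulr_ge0// exprn_ge0.
  elim: n => [|n IHn]; first by rewrite big_ord0 expr0 mulr1 subrr.
  by rewrite big_ord_recr/= IHn exprS; field.
have mG : measurable_fun D (fun t => \sum_(0 <= k <oo) (g k t)%:E)%E.
  apply: (ge0_emeasurable_sum (P := xpredT)) => [k t _ _|k _].
    by rewrite lee_fin.
  by apply/measurable_EFinP; exact: (bg k).1.
have iG : mu.-integrable D (fun t => \sum_(0 <= k <oo) (g k t)%:E)%E.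
  apply/integrableP; split => //.
  under eq_integral => t _.
    rewrite gee0_abs; last by apply: nneseries_ge0 => k _ _; rewrite lee_fin.
    over.
  rewrite integral_nneseries//; last 2 first.
  - by move=> k; apply/measurable_EFinP; exact: (bg k).1.
  - by move=> k t _; rewrite lee_fin.
  apply: (@le_lt_trans _ _ 2%:E); last exact: ltry.
  apply: lime_le.
    by apply: is_cvg_nneseries => k _ _; apply: integral_ge0 => t _; rewrite lee_fin.
  apply: nearW => n; rewrite big_mkord.
  apply: (@le_trans _ _ (\sum_(k < n) (2^-1 ^+ k)%:E)%E).
    apply: lee_sum => k _.
    have ig := integrable_bounded_measurable mD Dfin (bg k).
    rewrite -(fineK (integrable_fin_num mD ig)).
    by rewrite lee_fin; exact: hphi.
  by rewrite sumEFin lee_fin.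
apply: negligibleS (integrable_ae mD iG) => t /= + Gfin; apply => Dt.
have := nneseries_lty_cvg0 (g0^~ t) (Gfin Dt).
move=> /cvgrPdist_le g00; apply/cvgrPdist_le => eps eps0.
have e2 : 0 < eps ^+ 2 by rewrite exprn_gt0.
have := g00 _ e2; apply: filterS => k.
rewrite sub0r normrN ger0_norm// /g -real_normK ?num_real// => le2.
by rewrite -(@ler_sqr R) ?nnegrE// ltW.
Qed.

End FastSubsequence.

(** * Measures on the square with Lebesgue marginal *)

Section Square.
Context (R : realType) (mu : probability (measurableTypeR R * measurableTypeR R)%type R).
Local Notation leb := (@lebesgue_measure R).
Local Notation sq := (I01 `*` I01 : set (measurableTypeR R * measurableTypeR R)).

Lemma measurable_square : measurable sq.
Proof. by apply: measurableX; exact: measurable_I01. Qed.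

Lemma square_fin : (mu sq < +oo)%E.
Proof.
apply: (@le_lt_trans _ _ 1%E); last exact: ltry.
by apply: probability_le1; exact: measurable_square.
Qed.

Lemma bounded_measurable_fst : bounded_measurable sq (@fst R R).
Proof.
split; first by apply: measurable_funTS; exact: measurable_fst.
exists 1 => -[x t] [/= + _]; rewrite /I01/= in_itv/= => /andP[x0 x1].
by rewrite ger0_norm.
Qed.

Lemma bounded_measurable_snd : bounded_measurable sq (@snd R R).
Proof.
split; first by apply: measurable_funTS; exact: measurable_snd.
exists 1 => -[x t] [/= _]; rewrite /I01/= in_itv/= => /andP[x0 x1].
by rewrite ger0_norm.
Qed.

Let msq := measurable_square.
Let fsq := square_fin.
Let bfst := bounded_measurable_fst.
Let bsnd := bounded_measurable_snd.

Context (L : nat -> {poly R}).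
Hypothesis legL : shifted_legendre L.
Let sizeL : forall j, size (L j) = j.+1.
Proof. by have [] := legL. Qed.

Lemma Delta_mul_moment i j : Delta_mul L (moment mu i) j =
  \int[mu]_(p in sq) ((L j).[p.2] * p.1 ^+ i).
Proof.
rewrite (Rintegral_horner_mul msq fsq)//; last exact: bounded_measurableX.
by rewrite sizeL.
Qed.

(** This is the equivalence of the two forms of the power identities. *)
Lemma Delta_mul_moment_trajectory (x : R -> R) : trajectory x ->
  supported_on_trajectory mu x ->
  (fun i => Delta_mul L (moment mu i)) = fourier_pow L x.
Proof.
move=> tx mux; apply/funext => i; apply/funext => j.
have mI := @measurable_I01 R; have If := @lebesgue_measure_I01_fin R.
have bx := bounded_measurable_trajectory tx.
rewrite /fourier_pow /fourier_legendre.
rewrite (Rintegral_horner_mul mI If (f := id)); last 2 first.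
- exact: bounded_measurable_I01_id.
- exact: bounded_measurableX.
rewrite /Delta_mul sizeL; apply: eq_bigr => k _; congr (_ * _).
rewrite /moment /Rintegral (integral_trajectory tx mux)//.
- apply/measurable_EFinP/measurable_funM.
  + exact: (bounded_measurableX k bsnd).1.
  + exact: (bounded_measurableX i bfst).1.
- move=> p []; rewrite /I01/= !in_itv/= => /andP[p0 _] /andP[t0 _].
  by rewrite lee_fin mulr_ge0// exprn_ge0.
Qed.

Hypothesis mu_sq : mu (I01 `*` I01) = 1%E.
Hypothesis mu_snd : forall A : set (measurableTypeR R), measurable A ->
  pushforward mu snd A = lebesgue01 R A.

Lemma negligible_setC_square : mu (~` sq) = 0%E.
Proof. by rewrite probability_setC// mu_sq subee. Qed.

Lemma Rintegral_marginal (q : {poly R}) :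
  \int[mu]_(p in sq) q.[p.2] = \int[leb]_(t in I01) q.[t].
Proof.
have mI := @measurable_I01 R.
have mq : measurable_fun (setT : set (measurableTypeR R)) (EFin \o horner q).
  by apply/measurable_EFinP; exact: measurable_poly.
congr fine.
pose F (p : measurableTypeR R * measurableTypeR R) := (q.[p.2])%:E.
have msnd : measurable (snd @^-1` I01 : set (measurableTypeR R * measurableTypeR R)).
  by rewrite -[X in measurable X]setTI; exact: measurable_snd.
have ssq : sq `<=` snd @^-1` I01 by move=> p [].
have N0 : mu (snd @^-1` I01 `\` sq) = 0%E.
  apply: (subset_measure0 _ _ _ negligible_setC_square) => //.
  - exact: measurableD.
  - exact: measurableC.
have bF : bounded_measurable
    (snd @^-1` I01 : set (measurableTypeR R * measurableTypeR R))
    (fun p => q.[p.2]).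
  apply: bounded_measurable_poly; split.
    by apply: measurable_funTS; exact: measurable_snd.
  exists 1 => p; rewrite /I01/= in_itv/= => /andP[t0 t1].
  by rewrite ger0_norm.
have iF : mu.-integrable (snd @^-1` I01) F.
  apply: integrable_bounded_measurable bF => //.
  apply: (@le_lt_trans _ _ 1%E); last exact: ltry.
  exact: probability_le1.
transitivity (\int[mu]_(p in snd @^-1` I01) F p)%E.
  rewrite (negligible_integral _ _ iF N0)//; last exact: measurableD.
  by rewrite setDD; move/setIidPr: ssq => ->.
have mS : measurable_fun (setT : set (measurableTypeR R * measurableTypeR R)) snd.
  exact: measurable_snd.
rewrite -[LHS](integral_pushforward mS mq iF mI).
apply: eq_measure_integral => A mA /setIidPl AI.
by rewrite [LHS](mu_snd mA) /lebesgue01/= /mrestr AI.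
Qed.

Lemma orthonormal_square j k :
  \int[mu]_(p in sq) ((L j).[p.2] * (L k).[p.2]) = (j == k)%:R.
Proof.
under eq_Rintegral do rewrite -hornerM.
rewrite Rintegral_marginal; under eq_Rintegral do rewrite hornerM.
by have [_ _] := legL.
Qed.

Let bL j : bounded_measurable sq (fun p => (L j).[p.2]).
Proof. exact: bounded_measurable_poly. Qed.

(** The heart of the converse. In $L_2(\mu)$ the functions $\mathscr{L}_j(t)$ are
    orthonormal and the coefficients of the function $(x,t)\mapsto x$ are
    $a=\Delta\gamma_1$, so that
    $\int(x-s_n(t))^2\,d\mu = \int x^2\,d\mu - \sum_{j\le n} a(j)^2$.
    The coordinate of index $0$ of the identity for $i=2$ says that
    $\sum_{j\le n}a(j)^2=\int_0^1 s_n^2$ tends to $\int x^2\,d\mu$. *)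
Lemma legendre_sum_cvg_square : identity_II L mu ->
  \int[mu]_(p in sq) (p.1 -
    (legendre_sum L n (Delta_mul L (moment mu 1))).[p.2]) ^+ 2 @[n --> \oo]
    --> (0 : R).
Proof.
move=> II; have [conv2 _] := II 2%N isT.
set a := Delta_mul L (moment mu 1) in conv2 *.
have aE j : \int[mu]_(p in sq) ((L j).[p.2] * p.1) = a j.
  by rewrite /a Delta_mul_moment; apply: eq_Rintegral => p _; rewrite expr1.
have mI := @measurable_I01 R; have If := @lebesgue_measure_I01_fin R.
have L0 : (L 0%N)`_0 != 0.
  have := lead_coef_eq0 (L 0%N); rewrite lead_coefE sizeL /= => ->.
  by rewrite -size_poly_eq0 sizeL.
have L0E : L 0%N = ((L 0%N)`_0)%:P by apply: size1_polyC; rewrite sizeL.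
have sumE n : trunc_pow L 2 a n 0%N = (L 0%N)`_0 * \sum_(j < n.+1) a j ^+ 2.
  rewrite /trunc_pow legendre_coord_fourier ?size_legendre_sum_exp//.
  rewrite /fourier_legendre.
  under eq_Rintegral do rewrite L0E hornerC horner_exp.
  have bs := bounded_measurable_horner (legendre_sum L n a).
  rewrite (RintegralZl_bounded mI If); last exact: bounded_measurableX.
  congr (_ * _); under eq_Rintegral do rewrite horner_legendre_sum.
  have bL' j := bounded_measurable_horner (L j); have [_ _ oL] := legL.
  exact: (Rintegral_sqr_lincomb mI If bL' oL).
pose gam := \int[mu]_(p in sq) p.1 ^+ 2.
have gamE : Delta_mul L (moment mu 2) 0%N = (L 0%N)`_0 * gam.
  rewrite /Delta_mul big_ord1; congr (_ * _).
  by apply: eq_Rintegral => p _; rewrite mul1r.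
have sumcvg : \sum_(j < n.+1) a j ^+ 2 @[n --> \oo] --> gam.
  have := cvg_l2_coord (k := 0%N) conv2; rewrite gamE => h.
  have : ((L 0%N)`_0)^-1 * trunc_pow L 2 a n 0%N @[n --> \oo] -->
      ((L 0%N)`_0)^-1 * ((L 0%N)`_0 * gam) by apply: cvgM => //; exact: cvg_cst.
  rewrite mulKf//; apply: cvg_trans; apply: near_eq_cvg; apply: nearW => n /=.
  by rewrite sumE mulKf.
rewrite -(subrr gam).
have : gam - \sum_(j < n.+1) a j ^+ 2 @[n --> \oo] --> gam - gam.
  by apply: cvgB => //; exact: cvg_cst.
apply: cvg_trans; apply: near_eq_cvg; apply: nearW => n /=.
have := Rintegral_sqr_sub_lincomb msq fsq bL orthonormal_square n.+1 a bfst.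
rewrite /=; under eq_bigr do rewrite aE.
rewrite [X in _ = _ + X -> _]big1 ?addr0 => [|j _]; last by rewrite aE subrr expr0n.
move=> <-; apply: eq_Rintegral => p _.
by rewrite horner_legendre_sum.
Qed.

(** If $x=m(t)$ holds $\mu$-almost everywhere, then $A$ differs by a null set from
    the set of the $(x,t)$ with $(m(t),t)\in A$, which depends on $t$ only; its
    measure is given by the marginal. *)
Lemma supported_on_trajectory_of_ae (m : R -> R) :
  measurable_fun setT (m : measurableTypeR R -> measurableTypeR R) ->
  {ae mu, forall p, sq p -> p.1 = m p.2} -> supported_on_trajectory mu m.
Proof.
move=> mm [N [mN N0 subN]] A mA; have mI := @measurable_I01 R.
pose phi (t : measurableTypeR R) : measurableTypeR R * measurableTypeR R := (m t, t).
have mphi : measurable_fun setT phi by exact: measurable_fun_pair.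
have mB : measurable (phi @^-1` A).
  by rewrite -[X in measurable X]setTI; exact: (mphi measurableT _ mA).
have -> : (\int[leb]_(t in I01) \d_(m t) (ysection A t) =
    mu (snd @^-1` (phi @^-1` A)))%E.
  rewrite -[RHS]/(pushforward mu snd _) (mu_snd mB).
  transitivity (\int[leb]_(t in I01) (\1_(phi @^-1` A) t)%:E)%E;
    last exact: integral_indic.
  apply: eq_integral => t _; rewrite diracE indicE mem_ysection.
  by congr ((_ : bool)%:R%:E); apply/idP/idP; rewrite !inE.
have mB' : measurable
    (snd @^-1` (phi @^-1` A) : set (measurableTypeR R * measurableTypeR R)).
  by rewrite -[X in measurable X]setTI; exact: measurable_snd.
pose Z : set (measurableTypeR R * measurableTypeR R) := N `|` ~` sq.
have mZ : measurable Z by apply: measurableU => //; exact: measurableC.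
have Z0 : mu Z = 0%E.
  rewrite /Z measureU0//; first exact: measurableC.
  exact: negligible_setC_square.
rewrite -(measureU0 mA mZ Z0) -(measureU0 mB' mZ Z0); congr (mu _).
apply/seteqP; split => p [Ap|]; try by right.
  have [Zp|nZ] := pselect (Z p); [by right|left].
  move: nZ => /not_orP[nN /contrapT sqp].
  have pE : p.1 = m p.2.
    by apply: contrapT => pm; apply: nN; apply: subN => /= /(_ sqp).
  by rewrite /preimage/= /phi -pE -surjective_pairing.
have [Zp|nZ] := pselect (Z p); [by right|left].
move: nZ => /not_orP[nN /contrapT sqp].
have pE : p.1 = m p.2.
  by apply: contrapT => pm; apply: nN; apply: subN => /= /(_ sqp).
by move: Ap; rewrite /preimage/= /phi -pE -surjective_pairing.
Qed.

(** A pointwise limit of functions of $t$ is a function of $t$. The upper limit,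
    clipped to $[0,1]$, makes it measurable and defined everywhere. *)
Lemma trajectory_of_identity_II : identity_II L mu ->
  exists x : R -> R, trajectory x /\ supported_on_trajectory mu x.
Proof.
move=> II; set a := Delta_mul L (moment mu 1).
pose s n (p : measurableTypeR R * measurableTypeR R) := (legendre_sum L n a).[p.2].
have bs n : bounded_measurable sq (s n) by exact: bounded_measurable_poly.
have [phi sphi] := cvg_L2_subseq_ae msq fsq bfst bs (legendre_sum_cvg_square II).
pose m t := clip 0 1 (fine (limn_esup (fun k => (legendre_sum L (phi k) a).[t]%:E))).
have m01 t : 0 <= m t <= 1 by exact: clip_itv.
have mm : measurable_fun setT (m : measurableTypeR R -> measurableTypeR R).
  apply: measurable_maxr; first exact: measurable_cst.
  apply: measurable_minr; first exact: measurable_cst.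
  apply: (@measurableT_comp _ _ _ _ _ _ fine); first exact: fine_measurable.
  apply: measurable_fun_limn_esup => k; apply/measurable_EFinP.
  exact: measurable_poly.
exists m; split.
  split; first exact: measurable_funTS.
  by move=> t _; rewrite /I01/= in_itv/=.
apply: supported_on_trajectory_of_ae => //.
apply: negligibleS sphi => p /= + cvgp; apply => sqp.
have sp : (s (phi k) p)%:E @[k --> \oo] --> (p.1)%:E.
  by apply: cvg_EFin; [exact: nearW|exact: cvgp].
rewrite /m (cvg_limn_einf_sup sp).2/= clip_id//.
by case: sqp; rewrite /I01/= in_itv.
Qed.

End Square.

Theorem theorem3p1 (R : realType) (L : nat -> {poly R})
    (mu : probability (measurableTypeR R * measurableTypeR R)%type R) :
  shifted_legendre L ->
  mu (I01 `*` I01) = 1%E ->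
  (forall A : set (measurableTypeR R), measurable A ->
     pushforward mu snd A = lebesgue01 R A) ->
  (forall x : R -> R,
     trajectory x ->
     supported_on_trajectory mu x ->
     (ereal_sup (range (fun n : nat =>
        sup_norm01 (horner (legendre_sum L n (fourier_legendre L x))))) < +oo)%E ->
     identity_I L x /\ identity_II L mu) /\
  (identity_II L mu ->
   exists x : R -> R,
     [/\ trajectory x, supported_on_trajectory mu x & identity_I L x]).
Proof.
move=> legL mu_sq mu_snd; split => [x tx mux sup_fin|II].
  have I := identity_I_of_bounded_sums legL tx sup_fin.
  by split=> //; rewrite /identity_II (Delta_mul_moment_trajectory legL tx mux).
have [x [tx mux]] := trajectory_of_identity_II legL mu_sq mu_snd II.
exists x; split=> //.
by rewrite /identity_I -(Delta_mul_moment_trajectory legL tx mux).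
Qed.
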